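(* Let $m\ge 1$ be an integer, let $\Lambda\in\mathbf{SO}^+(1,m+1)$ and $r\in\mathbb{R}$, and let $\iota_m:\mathbb{L}^m\to\mathbb{L}^{m+1}$ be the map $$\iota_m(x)=\Lambda\begin{bmatrix}\cosh(r)\,x\\ \sinh(r)\end{bmatrix}.$$ If $r=0$, then $\iota_m$ is isometric, i.e. $d_{\mathbb{L}}(\iota_m(x),\iota_m(y))=d_{\mathbb{L}}(x,y)$ for all $x,y\in\mathbb{L}^m$.
   Context: For $n\ge 1$, the Lorentzian inner product on $\mathbb{R}^{n+1}$ is $\langle x,y\rangle_L=-x_0y_0+x_1y_1+\cdots+x_ny_n$. The hyperboloid model of $n$-dimensional hyperbolic space is $\mathbb{L}^n=\{x=[x_0,\ldots,x_n]^T\in\mathbb{R}^{n+1}:\langle x,x\rangle_L=-1,\ x_0>0\}$, with Riemannian metric the restriction of $\langle\cdot,\cdot\rangle_L$ to tangent spaces and geodesic distance $d_{\mathbb{L}}(x,y)=\cosh^{-1}(-\langle x,y\rangle_L)$. Let $J_n=\mathrm{diag}(-1,I_n)$, where $I_n$ is the $n\times n$ identity matrix. The positive special Lorentz group is $\mathbf{SO}^+(1,n)=\{A\in M_{n+1}(\mathbb{R}): AJ_nA^T=A^TJ_nA=J_n,\ \det A=1,\ a_{11}>0\}$, where $a_{11}$ is the top-left entry of $A$; it acts on $\mathbb{L}^n$ by $x\mapsto Ax$. *)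

(* Defs.v *)
From HB Require Import structures.
From mathcomp Require Import all_boot all_order all_algebra.
From mathcomp Require Import ring lra.
From mathcomp Require Import boolp classical_sets reals sequences exp.

Set Implicit Arguments.
Unset Strict Implicit.
Unset Printing Implicit Defensive.

Import Order.TTheory GRing.Theory Num.Theory.

Local Open Scope classical_set_scope.
Local Open Scope ring_scope.

Section HyperbolicFunctions.
Context {R : realType}.
Implicit Types t x : R.

Definition cosh t := (expR t + expR (- t)) / 2.
Definition sinh t := (expR t - expR (- t)) / 2.

(* Inverse of cosh : [0, +oo[ -> [1, +oo[ ; meaningful for 1 <= x only
   (see arcoshK and coshK). *)
Definition arcosh x : R := xget 0 [set t | 0 <= t /\ cosh t = x].

Lemma cosh2Bsinh2 t : cosh t ^+ 2 - sinh t ^+ 2 = 1.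
Proof.
have h : expR t * expR (- t) = 1 by rewrite expRxMexpNx_1.
by rewrite /cosh /sinh -[RHS]h; field.
Qed.

Lemma cosh_gt0 t : 0 < cosh t.
Proof. by rewrite /cosh divr_gt0// addr_gt0// expR_gt0. Qed.

Lemma cosh_inj_ge0 t u : 0 <= t -> 0 <= u -> cosh t = cosh u -> t = u.
Proof.
move=> t0 u0; rewrite /cosh => tu.
have e : (expR t - expR u) * (expR t * expR u - 1) = 0.
  have ht : expR t * expR (- t) = 1 by rewrite expRxMexpNx_1.
  have hu : expR u * expR (- u) = 1 by rewrite expRxMexpNx_1.
  have tu' : expR t + expR (- t) = expR u + expR (- u) by lra.
  transitivity (expR t * expR u * ((expR t + expR (- t))
    - (expR u + expR (- u)))
    - expR u * (expR t * expR (- t) - 1) + expR t * (expR u * expR (- u) - 1)).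
    by ring.
  by rewrite tu' ht hu !subrr !mulr0 subrr addr0.
move/eqP: e; rewrite mulf_eq0 !subr_eq0 => /orP[/eqP/expR_inj//|].
rewrite -expRD -expR0 => /eqP/expR_inj tu0; lra.
Qed.

Lemma coshK t : 0 <= t -> arcosh (cosh t) = t.
Proof.
move=> t0; rewrite /arcosh.
have [|u0 ut] := @xgetPex _ 0 [set u | 0 <= u /\ cosh u = cosh t].
  by exists t.
exact: cosh_inj_ge0.
Qed.

Lemma arcosh_subproof x : 1 <= x -> exists t, 0 <= t /\ cosh t = x.
Proof.
move=> x1; pose s := Num.sqrt (x ^+ 2 - 1).
have s0 : 0 <= s by rewrite sqrtr_ge0.
have s2 : s ^+ 2 = x ^+ 2 - 1 by rewrite sqr_sqrtr//; nra.
have xs : 1 <= x + s by lra.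
exists (ln (x + s)); split; first by rewrite ln_ge0.
have xs0 : 0 < x + s by lra.
rewrite /cosh expRN lnK ?posrE//.
have -> : (x + s)^-1 = x - s.
  apply: (mulfI (lt0r_neq0 xs0)); rewrite divff ?lt0r_neq0//.
  by rewrite mulrC -subr_sqr s2; ring.
lra.
Qed.

Lemma arcosh_ge0 x : 1 <= x -> 0 <= arcosh x.
Proof. by case/arcosh_subproof => t [t0 <-]; rewrite coshK. Qed.

Lemma arcoshK x : 1 <= x -> cosh (arcosh x) = x.
Proof. by case/arcosh_subproof => t [t0 <-]; rewrite coshK. Qed.

End HyperbolicFunctions.

Section Lorentz.
Context {R : realType}.

Definition lorentz n (x y : 'cV[R]_n.+1) : R :=
  - (x 0 0 * y 0 0) + \sum_(i < n) x (lift 0 i) 0 * y (lift 0 i) 0.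

Definition lorentz_J n : 'M[R]_n.+1 :=
  block_mx (- 1)%:M 0 0 1%:M : 'M[R]_(1 + n).

Definition on_hyperboloid n : pred 'cV[R]_n.+1 :=
  fun x => (lorentz x x == - 1) && (0 < x 0 0).

Record hyperboloid n := Hyperboloid {
  hyperboloid_val :> 'cV[R]_n.+1;
  hyperboloidP : on_hyperboloid hyperboloid_val
}.

HB.instance Definition _ n := [isSub for @hyperboloid_val n].

Definition hyperboloid_dist n (x y : hyperboloid n) : R :=
  arcosh (- lorentz x y).

Definition in_SOp n : pred 'M[R]_n.+1 :=
  fun A => [&& A *m lorentz_J n *m A^T == lorentz_J n,
               A^T *m lorentz_J n *m A == lorentz_J n,
               \det A == 1 & 0 < A 0 0].

(* SO^+(1, n) *)
Record SOp n := SOpMatrix {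
  SOp_val :> 'M[R]_n.+1;
  SOpP : in_SOp SOp_val
}.

HB.instance Definition _ n := [isSub for @SOp_val n].

Lemma lorentz_JE n (i j : 'I_n.+1) :
  lorentz_J n i j = (if i == 0 then - 1 else 1) *+ (i == j).
Proof.
rewrite /lorentz_J -(splitK (i : 'I_(1 + n))) -(splitK (j : 'I_(1 + n))).
case: (split _) => i'; case: (split _) => j' /=.
- by apply: (etrans (block_mxEul _ _ _ _ _ _)); rewrite !ord1 !mxE.
- by apply: (etrans (block_mxEur _ _ _ _ _ _)); rewrite !ord1 !mxE.
- by apply: (etrans (block_mxEdl _ _ _ _ _ _)); rewrite !ord1 !mxE.
- apply: (etrans (block_mxEdr _ _ _ _ _ _)).
  by rewrite mxE; congr (_ *+ nat_of_bool _).
Qed.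

Lemma lorentzE n (x y : 'cV[R]_n.+1) :
  lorentz x y = (x^T *m lorentz_J n *m y) 0 0.
Proof.
move: (lorentz_J n) (@lorentz_JE n) => J Jl.
rewrite mxE [RHS]big_ord_recl/= /lorentz; congr (_ + _).
  rewrite mxE big_ord_recl big1 => [|i _]; rewrite !mxE Jl//=.
    by rewrite mulr1n addr0 mulrN1 mulNr.
  by rewrite mulr0.
apply: eq_bigr => i _; congr (_ * _).
rewrite mxE (bigD1 (lift 0 i))//= big1 => [|j ji]; rewrite !mxE Jl//=.
  by rewrite eqxx mulr1n addr0 mulr1.
by rewrite (negbTE ji) mulr0.
Qed.

Lemma lorentz_SOp n (A : SOp n) (x y : 'cV[R]_n.+1) :
  lorentz (A *m x) (A *m y) = lorentz x y.
Proof.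
have /and4P[_ /eqP AJ _ _] := SOpP A.
by rewrite !lorentzE trmx_mul -{2}AJ !mulmxA.
Qed.

Lemma SOp_act_subproof n (A : SOp n) (x : hyperboloid n) :
  on_hyperboloid (A *m x : 'cV[R]_n.+1).
Proof.
have /andP[/eqP xx x0] := hyperboloidP x.
apply/andP; split; first by rewrite lorentz_SOp xx.
have /and4P[/eqP AJ _ _ A0] := SOpP A.
pose a : 'cV[R]_n.+1 := (row 0 A)^T.
have aE i : a i 0 = A 0 i by rewrite !mxE.
have aa : lorentz a a = - 1.
  rewrite lorentzE /a trmxK tr_row -row_mul colE mulmxA -row_mul AJ -colE.
  by rewrite 2![LHS]mxE lorentz_JE.
have -> : (A *m x) 0 0
    = a 0 0 * x 0 0 + \sum_(i < n) a (lift 0 i) 0 * x (lift 0 i) 0.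
  rewrite [LHS]mxE big_ord_recl -aE; congr (_ + _).
  by apply: eq_bigr => i _; rewrite aE.
move: A0 aa xx; rewrite -aE /lorentz.
move: (a 0 0) (hyperboloid_val x 0 0) x0 => p q q0 p0.
set sa := \sum_i _ => aa; set sx := \sum_i _ => xx; set sax := \sum_i _.
have : 0 <= \sum_(i < n) (q * a (lift 0 i) 0 + p * x (lift 0 i) 0) ^+ 2.
  by apply: sumr_ge0 => i _; exact: sqr_ge0.
have -> : \sum_(i < n) (q * a (lift 0 i) 0 + p * x (lift 0 i) 0) ^+ 2
    = q ^+ 2 * sa + 2 * p * q * sax + p ^+ 2 * sx.
  rewrite /sa /sx /sax !mulr_sumr -!big_split/=.
  by apply: eq_bigr => i _; ring.
have -> : sa = p ^+ 2 - 1 by move: aa; rewrite expr2; lra.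
have -> : sx = q ^+ 2 - 1 by move: xx; rewrite expr2; lra.
move=> h; have pq : 0 < p * q by exact: mulr_gt0.
have q2 : 0 < q ^+ 2 by exact: exprn_gt0.
have p2 : 0 < p ^+ 2 by exact: exprn_gt0.
have : 0 < (p * q) * (p * q + sax) by nra.
by rewrite pmulr_rgt0.
Qed.

Definition SOp_act n (A : SOp n) (x : hyperboloid n) : hyperboloid n :=
  Hyperboloid (SOp_act_subproof A x).

(* The column [cosh r x; sinh r]; (m + 1).+1 and m.+1 + 1 are convertible. *)
Definition hyp_lift m (r : R) (x : 'cV[R]_m.+1) : 'cV[R]_(m + 1).+1 :=
  col_mx (cosh r *: x) (sinh r)%:M : 'cV[R]_(m.+1 + 1).

Lemma hyp_lift_subproof m (r : R) (x : hyperboloid m) :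
  on_hyperboloid (hyp_lift r x).
Proof.
have /andP[/eqP xx x0] := hyperboloidP x.
have Eu (k : 'I_(m + 1).+1) (l : 'I_m.+1) : k = lshift 1 l ->
    hyp_lift r x k 0 = cosh r * x l 0.
  by move=> ->; apply: (etrans (col_mxEu _ _ _ _)); rewrite mxE.
have E0 : hyp_lift r x 0 0 = cosh r * x 0 0 by apply: Eu; exact: val_inj.
have El (i : 'I_m) : hyp_lift r x (lift 0 (lshift 1 i)) 0
    = cosh r * x (lift 0 i) 0 by apply: Eu; exact: val_inj.
have Er (i : 'I_1) : hyp_lift r x (lift 0 (rshift m i)) 0 = sinh r.
  have -> : lift 0 (rshift m i) = rshift m.+1 i by exact: val_inj.
  by apply: (etrans (col_mxEd _ _ _ _)); rewrite ord1 mxE.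
apply/andP; split; last by rewrite E0 mulr_gt0 ?cosh_gt0.
have sE : \sum_(i < m) x (lift 0 i) 0 * x (lift 0 i) 0 = x 0 0 * x 0 0 - 1.
  by move: xx; rewrite /lorentz; lra.
rewrite /lorentz big_split_ord/= big_ord1 E0 Er.
under eq_bigr do rewrite El mulrACA.
rewrite -mulr_sumr sE; apply/eqP.
by have := cosh2Bsinh2 r; rewrite !expr2; lra.
Qed.

Definition iota_hyp m (L : SOp (m + 1)) (r : R) (x : hyperboloid m) :
    hyperboloid (m + 1) :=
  SOp_act L (Hyperboloid (hyp_lift_subproof r x)).

End Lorentz.

Arguments hyperboloid R n : clear implicits.
Arguments SOp R n : clear implicits.

(* Main.v *)
Require Import Defs.
From mathcomp Require Import all_boot all_order all_algebra.
From mathcomp Require Import ring.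
From mathcomp Require Import reals sequences exp.

Import Order.TTheory GRing.Theory Num.Theory.

Local Open Scope ring_scope.

(** The distance depends only on the Lorentz product. [Lambda] preserves that product
    ([lorentz_SOp]), and the lift changes it by the affine map [t] to
    [cosh r ^+ 2 * t + sinh r ^+ 2] ([lorentz_hyp_lift]), which is the identity at [r = 0]. *)

Lemma cosh0 (R : realType) : cosh (0 : R) = 1.
Proof. by rewrite /cosh oppr0 expR0; field. Qed.

Lemma sinh0 (R : realType) : sinh (0 : R) = 0.
Proof. by rewrite /sinh oppr0 subrr mul0r. Qed.

(** The old coordinates are all scaled by [cosh r] in both arguments; the appended one is spacelike,
    so its square enters with a plus sign. *)
Lemma lorentz_hyp_lift (R : realType) m (r : R) (x y : 'cV[R]_m.+1) :
  lorentz (hyp_lift r x) (hyp_lift r y)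
  = cosh r ^+ 2 * lorentz x y + sinh r ^+ 2.
Proof.
(* [lorentz] indexes by [0] and [lift 0 _], [col_mx] by [lshift] and [rshift]; the equation on [k]
   lets [val_inj] match them by value. *)
have Eu (z : 'cV[R]_m.+1) (k : 'I_(m + 1).+1) (l : 'I_m.+1) :
    k = lshift 1 l -> hyp_lift r z k 0 = cosh r * z l 0.
  by move=> ->; apply: (etrans (col_mxEu _ _ _ _)); rewrite mxE.
have E0 (z : 'cV[R]_m.+1) : hyp_lift r z 0 0 = cosh r * z 0 0
    by apply: Eu; exact: val_inj.
have El (z : 'cV[R]_m.+1) (i : 'I_m) :
    hyp_lift r z (lift 0 (lshift 1 i)) 0
    = cosh r * z (lift 0 i) 0 by apply: Eu; exact: val_inj.
have Er (z : 'cV[R]_m.+1) (i : 'I_1) :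
    hyp_lift r z (lift 0 (rshift m i)) 0 = sinh r.
  have -> : lift 0 (rshift m i) = rshift m.+1 i by exact: val_inj.
  by apply: (etrans (col_mxEd _ _ _ _)); rewrite ord1 mxE.
rewrite /lorentz big_split_ord/= big_ord1 !E0 !Er.
under eq_bigr do rewrite !El mulrACA.
by rewrite -mulr_sumr; ring.
Qed.

Theorem proposition1 (R : realType) (m : nat) (hm : (1 <= m)%N)
    (Lambda : SOp R (m + 1)) (r : R) (hr : r = 0) :
  forall x y : hyperboloid R m,
    hyperboloid_dist (iota_hyp Lambda r x) (iota_hyp Lambda r y)
    = hyperboloid_dist x y.
Proof.
(* Here [/=] exposes the underlying columns [Lambda *m hyp_lift r _]. *)
move=> x y; rewrite /hyperboloid_dist /= lorentz_SOp lorentz_hyp_lift hr.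
by rewrite cosh0 sinh0 expr1n mul1r expr0n addr0.
Qed.
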